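(* Let $A$ be an $m\times n$ matrix of rank $r$ over a field and let $A=PLUQ$ be a PLUQ decomposition computed by Gaussian elimination with a pivoting strategy minimizing the reverse lexicographic order and performing row rotations. Let $S_\tau$ be the $r\times r$ permutation matrix such that $P_{*,1..r}S_\tau$ is in column echelon form, and $S_\chi$ the $r\times r$ permutation matrix such that $S_\chi Q_{1..r,*}$ is in row echelon form. Set $X=PLS_\tau$, $F=S_\tau^TS_\chi^T$, $Y=S_\chi UQ$. Then $A=XFY$ is the unique generalized Bruhat decomposition of $A$, i.e. the unique factorization $A=XFY$ in which $X$ is an $m\times r$ matrix in column echelon form with leading entries equal to one, $Y$ is an $r\times n$ matrix in row echelon form, $F$ is an $r\times r$ permutation matrix, and $F^TX_{\mathrm{RowRP}(X),*}F$ is lower triangular.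
   Context: A PLUQ decomposition of an $m\times n$ matrix $A$ of rank $r$ is $A=PLUQ$ with $P$ ($m\times m$) and $Q$ ($n\times n$) permutation matrices, $L$ an $m\times r$ lower triangular (trapezoidal) matrix with unit diagonal and $U$ an $r\times n$ upper triangular (trapezoidal) matrix with nonzero diagonal. $P_{*,1..r}$ denotes the first $r$ columns of $P$, and $Q_{1..r,*}$ the first $r$ rows of $Q$. A matrix is in row echelon form if its zero rows come last and the column indices of the leftmost nonzero (leading) entries of its nonzero rows are strictly increasing; column echelon form is the transposed notion. $\mathrm{RowRP}(X)$ is the row rank profile of $X$ (the lexicographically smallest sequence of $\operatorname{rank}(X)$ indices of linearly independent rows), and $X_{I,*}$ is the sub-matrix formed by the rows of index in $I$. Gaussian elimination computes the decomposition one pivot at a time: at step $k$ a nonzero pivot is searched in the current remaining matrix (the Schur complement of the previous pivots, on the still unprocessed rows and columns in their current order), it is moved to position $(k,k)$ by a row permutation and a column permutation (a transposition or a rotation for columns), and the update $a_{i,j}\leftarrow a_{i,j}-a_{i,k}a_{k,k}^{-1}a_{k,j}$ is applied to the remaining rows and columns. Minimizing the reverse lexicographic order means that the pivot is the topmost nonzero element of the first nonzero column of the remaining matrix. Row rotations means that a pivot in row $i\ge k$ is brought to row $k$ by the cyclic shift that moves row $i$ to position $k$ and shifts rows $k,\dots,i-1$ down by one, preserving their order. *)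

(* Defs.v *)
From HB Require Import structures.
From mathcomp Require Import all_boot all_order all_fingroup all_algebra.

Set Implicit Arguments.
Unset Strict Implicit.
Unset Printing Implicit Defensive.

Import Order.TTheory GRing.Theory.
Local Open Scope ring_scope.

(* Rows and columns are numbered from 0. *)

Lemma rank_le_rows (K : fieldType) m n (A : 'M[K]_(m, n)) r :
  \rank A = r -> (r <= m)%N.
Proof. by move=> <-; apply: rank_leq_row. Qed.

Lemma rank_le_cols (K : fieldType) m n (A : 'M[K]_(m, n)) r :
  \rank A = r -> (r <= n)%N.
Proof. by move=> <-; apply: rank_leq_col. Qed.

Section Echelon.
Variables (K : fieldType) (p q : nat).
Implicit Type M : 'M[K]_(p, q).

Definition leading M (i : 'I_p) (j : 'I_q) : Prop :=
  M i j != 0 /\ forall j' : 'I_q, (j' < j)%N -> M i j' = 0.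

Definition row_echelon M : Prop :=
  (forall i i' : 'I_p, (i < i')%N -> row i M = 0 -> row i' M = 0) /\
  (forall (i i' : 'I_p) (j j' : 'I_q), (i < i')%N ->
     leading M i j -> leading M i' j' -> (j < j')%N).
End Echelon.

Definition col_echelon (K : fieldType) p q (M : 'M[K]_(p, q)) : Prop :=
  row_echelon M^T.

(* [maxrankfun X] only serves as the default value required by [arg min]. *)
Definition RowRP (K : fieldType) m n (X : 'M[K]_(m, n)) :
    (\rank X).-tuple 'I_m :=
  [arg min_(I < [tuple maxrankfun X i | i < \rank X]
            | row_free (rowsub (tnth I) X))
     (I : (\rank X).-tuplelexi 'I_m)]%O.

Section PLUQ.
Variables (K : fieldType) (m n : nat).

(* [is_trig_mx] means lower triangular, also for rectangular matrices. *)
Definition is_PLUQ r (le_rm : (r <= m)%N) (le_rn : (r <= n)%N)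
    (A : 'M[K]_(m, n)) (P : 'M[K]_m) (L : 'M[K]_(m, r))
    (U : 'M[K]_(r, n)) (Q : 'M[K]_n) : Prop :=
  A = P *m L *m U *m Q /\
  [/\ is_perm_mx P, is_perm_mx Q,
      is_trig_mx L /\ (forall k : 'I_r, L (widen_ord le_rm k) k = 1)
    & is_trig_mx U^T /\ (forall k : 'I_r, U k (widen_ord le_rn k) != 0)].

(* [k] is the number of pivots already processed: the remaining matrix is the
   block of [B] formed by the rows and columns of index at least [k]. *)
Definition is_pivot (k : nat) (B : 'M[K]_(m, n)) (i : 'I_m) (j : 'I_n) : Prop :=
  [/\ (k <= i)%N, (k <= j)%N, B i j != 0,
      forall (x : 'I_m) (y : 'I_n), (k <= x)%N -> (k <= y < j)%N -> B x y = 0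
    & forall x : 'I_m, (k <= x < i)%N -> B x j = 0].

(* For k <= i: line [x] after the move is line [s x] before it. *)
Definition is_rotation p (k i : 'I_p) (s : 'S_p) : Prop :=
  forall x : 'I_p,
    s x = (if x == k then i : nat else if (k < x <= i)%N then x.-1 else x)
      :> nat.

Definition schur_update (k : 'I_m) (k' : 'I_n) (B : 'M[K]_(m, n)) :
    'M[K]_(m, n) :=
  \matrix_(i, j) if (k < i)%N && (k' < j)%N
                 then B i j - B i k' * (B k k')^-1 * B k j else B i j.

(* [gauss_steps A k P Q B]: from [A], after [k] steps, the accumulated
   permutation matrices are [P] and [Q] and the working array is [B].
   The elimination is in place: the entries of [B] outside of the remaining
   block hold the rows of U and, below the diagonal, the columns of L before
   their division by the pivot; later permutations apply to them as well. *)
Inductive gauss_steps (A : 'M[K]_(m, n)) :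
    nat -> 'M[K]_m -> 'M[K]_n -> 'M[K]_(m, n) -> Prop :=
| gauss_start : gauss_steps A 0 1%:M 1%:M A
| gauss_step (k : 'I_m) (k' : 'I_n) (P : 'M[K]_m) (Q : 'M[K]_n)
    (B : 'M[K]_(m, n)) (i : 'I_m) (j : 'I_n) (s : 'S_m) (t : 'S_n) :
    gauss_steps A k P Q B -> k = k' :> nat ->
    is_pivot k B i j ->
    is_rotation k i s ->
    t = tperm k' j \/ is_rotation k' j t ->
    gauss_steps A k.+1 (P *m (perm_mx s)^T) (perm_mx t *m Q)
      (schur_update k k' (row_perm s (col_perm t B))).

Definition lower_factor r (le_rm : (r <= m)%N) (le_rn : (r <= n)%N)
    (B : 'M[K]_(m, n)) : 'M[K]_(m, r) :=
  \matrix_(i, k)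
    if (i < k)%N then 0 else if i == k :> nat then 1
    else B i (widen_ord le_rn k)
         * (B (widen_ord le_rm k) (widen_ord le_rn k))^-1.

Definition upper_factor r (le_rm : (r <= m)%N) (B : 'M[K]_(m, n)) :
    'M[K]_(r, n) :=
  \matrix_(k, j) if (k <= j)%N then B (widen_ord le_rm k) j else 0.

Definition gauss_computes r (le_rm : (r <= m)%N) (le_rn : (r <= n)%N)
    (A : 'M[K]_(m, n)) (P : 'M[K]_m) (L : 'M[K]_(m, r))
    (U : 'M[K]_(r, n)) (Q : 'M[K]_n) : Prop :=
  exists B : 'M[K]_(m, n),
    [/\ gauss_steps A r P Q B,
        forall (i : 'I_m) (j : 'I_n), (r <= i)%N -> (r <= j)%N -> B i j = 0,
        L = lower_factor le_rm le_rn B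
      & U = upper_factor le_rm B].
End PLUQ.

Record generalized_bruhat (K : fieldType) (m n r : nat) (A : 'M[K]_(m, n))
    (X : 'M[K]_(m, r)) (F : 'M[K]_r) (Y : 'M[K]_(r, n)) : Prop := {
  bruhat_eq : A = X *m F *m Y;
  bruhat_X_echelon : col_echelon X;
  bruhat_X_leading : forall (i : 'I_m) (j : 'I_r), leading X^T j i -> X i j = 1;
  bruhat_Y_echelon : row_echelon Y;
  bruhat_F_perm : is_perm_mx F;
  (* The equality only makes the product with [F] well-typed. *)
  bruhat_trig : exists rX : \rank X = r,
    is_trig_mx (F^T *m castmx (rX, erefl r) (rowsub (tnth (RowRP X)) X) *m F)
}.

(* Main.v *)
Require Import Defs.
From HB Require Import structures.
From mathcomp Require Import all_boot all_order all_fingroup all_algebra.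
From mathcomp Require Import zify.
Set Implicit Arguments.
Unset Strict Implicit.
Unset Printing Implicit Defensive.
Import Order.TTheory GRing.Theory.
Local Open Scope ring_scope.

(* The pivots are met in increasing order of their original columns, so S_chi is
   the identity, and the row rotations keep the unprocessed rows in their
   original order, so the k-th column of PL has its leading entry 1 in the
   original row of the k-th pivot. The triangularity condition then says that
   the leading r x r block of L is lower triangular.

   For uniqueness, put G = XF. Two decompositions GY = G'Y' satisfy G' = GW and
   Y = WY'. Since Y and Y' are echelon, W is upper triangular. The rows of G that
   contain the leading entries of its columns, listed in the order of the
   columns, form a lower unitriangular matrix, and the same holds for G'. If G
   and G' agree on the first k columns, forward substitution in these rows kills
   the entries of the k-th column of W above the diagonal, and the normalization
   of the leading entries gives 1 on the diagonal. Hence W = 1, and the column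
   permutation that puts G in echelon form is unique. *)

(** * Echelon forms and their leading positions *)

Lemma increasing_ord_id r (f : 'I_r -> 'I_r) :
  {homo f : i j / (i < j)%N} -> f =1 id.
Proof.
move=> f_incr.
have f_ge (i : 'I_r) : (i <= f i)%N.
  have [k] := ubnP i; elim: k i => // k IHk [[|i] lti] //= ltik.
  have lti' : (i < r)%N by apply: ltnW.
  have := f_incr (Ordinal lti') (Ordinal lti) (ltnSn i).
  by apply: leq_ltn_trans; apply: (IHk (Ordinal lti')).
have f_le (i : 'I_r) : (f i <= i)%N.
  have [k] := ubnP (r - i); elim: k i => // k IHk i ltk.
  have [ltir | leri] := ltnP i.+1 r; last first.
    by rewrite -ltnS (leq_trans (ltn_ord (f i))).
  have := f_incr i (Ordinal ltir) (ltnSn i).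
  move=> /leq_trans/(_ (IHk (Ordinal ltir) _)); rewrite ltnS; apply.
  by rewrite -ltnS (leq_trans _ ltk) // ltnS subnSK // ltnW.
by move=> i; apply/val_inj/anti_leq; rewrite f_le f_ge.
Qed.

Section Echelon.
Variables (K : fieldType) (p q : nat).
Implicit Type M : 'M[K]_(p, q).

Lemma leading_inj M i j j' : leading M i j -> leading M i j' -> j = j'.
Proof.
move=> [nz_j z_j] [nz_j' z_j']; apply/val_inj; case: (ltngtP j j') => //.
  by move=> /z_j'/eqP; rewrite (negPf nz_j).
by move=> /z_j/eqP; rewrite (negPf nz_j').
Qed.

Lemma leading_exists M i : row i M != 0 -> {j | leading M i j}.
Proof.
move=> nz_i; have /sigW[j0 nz_j0] : exists j, M i j != 0.
  have /rV0Pn[j] := nz_i; rewrite mxE => nz_j; by exists j.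
have [j nz_j min_j] := @arg_minnP _ j0 (fun j => M i j != 0) (fun j => j) nz_j0.
exists j; split=> // j' lt_j'; apply/eqP; apply: contraTT lt_j' => nz_j'.
by rewrite -leqNgt min_j.
Qed.

Lemma row_echelon_leading M (c : 'I_p -> 'I_q) :
    {homo c : i j / (i < j)%N} -> (forall i, leading M i (c i)) ->
  row_echelon M.
Proof.
move=> c_incr cP; split=> [i i' _ | i i' j j' lt_ii'].
  move=> /rowP/(_ (c i)); rewrite !mxE => /eqP.
  by have [/negPf->] := cP i.
move=> /leading_inj-/(_ _ (cP i))-> /leading_inj-/(_ _ (cP i'))->.
exact: c_incr.
Qed.

Lemma row_echelonP M : row_echelon M -> row_free M ->
  exists2 c : 'I_p -> 'I_q,
    {homo c : i j / (i < j)%N} & forall i, leading M i (c i).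
Proof.
move=> [_ M_incr] M_free.
have nz_row i : row i M != 0.
  rewrite rowE mulmx_free_eq0 //; apply/rV0Pn; exists i.
  by rewrite mxE !eqxx oner_eq0.
exists (fun i => sval (leading_exists (nz_row i))) => [i i' lt_ii' | i].
  exact: M_incr lt_ii' (svalP (leading_exists _)) (svalP (leading_exists _)).
exact: svalP (leading_exists _).
Qed.

End Echelon.

Lemma row_free_tr (K : fieldType) m r (X : 'M[K]_(m, r)) :
  \rank X = r -> row_free X^T.
Proof. by move=> rX; rewrite /row_free mxrank_tr rX. Qed.

(** * Row rank profile of a matrix in column echelon form *)

Lemma RowRP_min (K : fieldType) m n (X : 'M[K]_(m, n)) :
  row_free (rowsub (tnth (RowRP X)) X) /\
  forall J : (\rank X).-tuplelexi 'I_m,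
    row_free (rowsub (tnth J) X) -> (RowRP X <= J :> (\rank X).-tuplelexi 'I_m)%O.
Proof.
rewrite /RowRP; case: arg_minP => [|I I_free I_min]; last by split.
have -> : rowsub (tnth [tuple maxrankfun X i | i < \rank X]) X
          = rowsub (maxrankfun X) X.
  by apply/matrixP => i j; rewrite !mxE tnth_mktuple.
exact: maxrowsub_free.
Qed.

Lemma pid_mulmx_id (K : fieldType) r k (N : 'M[K]_r) i j :
  ((pid_mx k : 'M_r) *m N) i j = if (i < k)%N then N i j else 0.
Proof.
rewrite mxE (bigD1 i) //= mxE eqxx /= big1 => [|l /negPf ne_li].
  by case: ifP => _; rewrite (mul1r, mul0r) addr0.
by rewrite mxE eq_sym val_eqE ne_li mul0r.
Qed.

Lemma mulmx_pid_id (K : fieldType) r k (N : 'M[K]_r) i j :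
  (N *m (pid_mx k : 'M_r)) i j = if (j < k)%N then N i j else 0.
Proof.
by rewrite -[in LHS](trmxK N) -tr_pid_mx -trmx_mul mxE pid_mulmx_id mxE.
Qed.

(** Rows [0] to [k] of [N] are supported on only [k] columns, so these [k + 1] rows cannot be
    independent. *)
Lemma unitmx_block0 (K : fieldType) r (k : 'I_r) (N : 'M[K]_r) :
  (forall i j : 'I_r, (i <= k <= j)%N -> N i j = 0) -> N \notin unitmx.
Proof.
move=> N0; apply/negP; rewrite -row_free_unit => N_free.
pose M := (pid_mx k.+1 : 'M_r) *m N.
have rM : \rank M = k.+1 by rewrite mxrankMfree // rank_pid_mx ?ltn_ord.
suff defM : M = M *m (pid_mx k : 'M_r).
  have := mxrankM_maxr M (pid_mx k : 'M_r).
  by rewrite -defM rM rank_pid_mx ?ltnn // ltnW.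
apply/matrixP=> i j; rewrite mulmx_pid_id.
case: ltnP => // le_kj; rewrite pid_mulmx_id.
by case: ltnP => // le_ik; rewrite N0 // -ltnS le_ik.
Qed.

Section ColumnEchelon.
Variables (K : fieldType) (m r : nat) (X : 'M[K]_(m, r)) (c : 'I_r -> 'I_m).
Hypotheses (c_incr : {homo c : i j / (i < j)%N})
           (cP : forall j, leading X^T j (c j)).

Lemma col_leading0 (x : 'I_m) (j : 'I_r) : (x < c j)%N -> X x j = 0.
Proof. by have [_ cj0] := cP j => /cj0; rewrite mxE. Qed.

Lemma rowsub_leading_unit : rowsub c X \in unitmx.
Proof.
rewrite unitmxE unitfE det_trig.
  apply/prodf_neq0 => j _; rewrite mxE.
  by have [] := cP j; rewrite mxE.
by apply/is_trig_mxP => i j lt_ij; rewrite mxE col_leading0 ?c_incr.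
Qed.

(** Minimality leaves [I = c] or a first difference [k] with [I k < c k]. In the second case rows
    [0] to [k] of the selection all lie above row [c k] of [X], hence vanish from column [k] on, and
    [unitmx_block0] contradicts freeness. *)
Lemma lex_min_rows (I : r.-tuplelexi 'I_m) :
    row_free (rowsub (tnth I) X) ->
    (forall J : r.-tuplelexi 'I_m,
       row_free (rowsub (tnth J) X) -> (I <= J)%O) ->
  tnth I =1 c.
Proof.
move=> I_free I_min j.
pose J : r.-tuplelexi 'I_m := [tuple c i | i < r].
have JE i : tnth J i = c i by rewrite tnth_mktuple.
have /I_min : row_free (rowsub (tnth J) X).
  rewrite row_free_unit.
  suff -> : rowsub (tnth J) X = rowsub c X by exact: rowsub_leading_unit.
  by apply/matrixP=> i i'; rewrite !mxE JE.
rewrite le_eqVlt => /predU1P[-> // | /ltxi_tuplePlt[k eqIJ ltIJ]].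
suff /negP[] : rowsub (tnth I) X \notin unitmx by rewrite -row_free_unit.
apply: (@unitmx_block0 _ _ k) => i i' /andP[le_ik le_ki']; rewrite mxE col_leading0 //.
have lt_ck : (tnth I i < c k)%N.
  case: (ltngtP i k) le_ik => // [lt_ik|/val_inj->] _.
    by rewrite eqIJ // JE c_incr.
  by rewrite -JE.
apply: leq_trans lt_ck _; case: (ltngtP k i') le_ki' => // [|/val_inj->//] lt _.
by rewrite ltnW ?c_incr.
Qed.

End ColumnEchelon.

Lemma RowRP_col_echelon (K : fieldType) m r (X : 'M[K]_(m, r))
    (c : 'I_r -> 'I_m) (rX : \rank X = r) :
    {homo c : i j / (i < j)%N} -> (forall j, leading X^T j (c j)) ->
  forall j, tnth (RowRP X) (cast_ord (esym rX) j) = c j.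
Proof.
move=> c_incr cP; have [] := RowRP_min X.
(* The tuple has length [\rank X], equal to [r] only propositionally; with a variable [d] in its
   place the equality can be eliminated. *)
suff gen d (e : d = r) (I : d.-tuplelexi 'I_m) :
    row_free (rowsub (tnth I) X) ->
    (forall J : d.-tuplelexi 'I_m,
       row_free (rowsub (tnth J) X) -> (I <= J)%O) ->
  forall j, tnth I (cast_ord (esym e) j) = c j by apply: gen.
case: r / e X {rX} c c_incr cP => X c c_incr cP I_free I_min j.
by rewrite cast_ord_id; apply: (lex_min_rows c_incr cP).
Qed.

(** * Uniqueness of the decomposition *)

Lemma increasing_mono p q (c : 'I_p -> 'I_q) :
  {homo c : i j / (i < j)%N} -> {mono c : i j / (i < j)%N}.
Proof.
move=> c_incr i j; case: (ltngtP i j) => [/c_incr-> // | /c_incr | /val_inj->].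
  by move=> lt_ji; rewrite ltnNge ltnW.
by rewrite ltnn.
Qed.

(** If row [i] of [W] leads at [l i], then row [i] of [W Y'] leads at [c' (l i)], because later rows
    of [Y'] start further right. Comparison with [c] makes [l] increasing, hence the identity. *)
Lemma echelon_transition (K : fieldType) r n (Y Y' : 'M[K]_(r, n)) (W : 'M[K]_r)
    (c c' : 'I_r -> 'I_n) :
    {homo c : i j / (i < j)%N} -> (forall i, leading Y i (c i)) ->
    {homo c' : i j / (i < j)%N} -> (forall i, leading Y' i (c' i)) ->
  Y = W *m Y' -> is_trig_mx W^T.
Proof.
move=> c_incr cP c'_incr c'P defY.
have nzW i : row i W != 0.
  have [nzY _] := cP i; apply: contraNneq nzY => W0.
  have -> : Y i (c i) = row i Y 0 (c i) by rewrite mxE.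
  by rewrite defY row_mul W0 mul0mx mxE.
pose l i := sval (leading_exists (nzW i)).
have lP i : leading W i (l i) := svalP (leading_exists (nzW i)).
have YlP i : leading Y i (c' (l i)).
  have [nzWl W0] := lP i; have [nzYl Y'0] := c'P (l i).
  split=> [|j ltj]; rewrite defY mxE.
    rewrite (bigD1 (l i)) //= big1 ?addr0 ?mulf_neq0 // => k ne_k.
    case: (ltngtP k (l i)) => [/W0->|lt_k|/val_inj eq_k]; first by rewrite mul0r.
      by have [_ ->] := c'P k; rewrite ?mulr0 ?c'_incr.
    by rewrite eq_k eqxx in ne_k.
  rewrite big1 // => k _; case: (ltnP k (l i)) => [/W0->|le_k]; first by rewrite mul0r.
  have [_ ->] := c'P k; rewrite ?mulr0 //; apply: leq_trans ltj _.
  by rewrite leqNgt (increasing_mono c'_incr) -leqNgt.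
have l_id : l =1 id.
  apply: increasing_ord_id => i j lt_ij; rewrite -(increasing_mono c'_incr).
  by rewrite -(leading_inj (cP i) (YlP i)) -(leading_inj (cP j) (YlP j)) c_incr.
apply/is_trig_mxP=> j i lt_ji; rewrite mxE.
by have [_ ->] := lP i; rewrite ?l_id.
Qed.

Lemma normal_cols_transition (K : fieldType) m r (G G' : 'M[K]_(m, r))
    (W : 'M[K]_r) (c c' : 'I_r -> 'I_m) :
    (forall k, leading G^T k (c k)) -> (forall k, G (c k) k = 1) ->
    is_trig_mx (rowsub c G) ->
    (forall k, leading G'^T k (c' k)) -> (forall k, G' (c' k) k = 1) ->
    is_trig_mx (rowsub c' G') ->
  G' = G *m W -> is_trig_mx W^T -> W = 1%:M.
Proof.
move=> cP G1 /is_trig_mxP trG c'P G'1 /is_trig_mxP trG' defG' /is_trig_mxP trW.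
have G0 (i j : 'I_r) : (i < j)%N -> G (c i) j = 0 by move/trG; rewrite mxE.
have G'0 (i j : 'I_r) : (i < j)%N -> G' (c' i) j = 0 by move/trG'; rewrite mxE.
have W0 (i j : 'I_r) : (j < i)%N -> W i j = 0 by move/trW; rewrite mxE.
suff colW (k : 'I_r) : forall l, W l k = (l == k)%:R.
  by apply/matrixP=> l k; rewrite colW mxE.
have [d] := ubnP k; elim: d k => // d IHd k; rewrite ltnS => le_kd.
have eqc (i : 'I_r) : (i < k)%N -> c' i = c i.
  move=> lt_ik; have Wi l := IHd i (leq_trans lt_ik le_kd) l.
  apply: leading_inj (c'P i) _; have [nz z] := cP i.
  have eqG x : G'^T i x = G^T i x.
    rewrite !mxE defG' mxE (bigD1 i) //= big1 ?Wi ?eqxx ?mulr1 ?addr0 // => l.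
    by rewrite Wi => /negPf->; rewrite mulr0.
  by split=> [|x /z]; rewrite eqG.
(* Entry [(c i, k)] of [G'] is zero since [c' i = c i]. In [G W] it equals [W i k] plus terms of
   index [l < i], which vanish by induction, and terms of index [l > i], where [G (c i) l = 0]. *)
have Wlt : forall i : 'I_r, (i < k)%N -> W i k = 0.
  move=> i; have [e] := ubnP i; elim: e i => // e IHe i; rewrite ltnS => le_ie lt_ik.
  have := G'0 _ _ lt_ik; rewrite eqc // defG' mxE (bigD1 i) //= G1 mul1r big1 ?addr0 //.
  move=> l ne_li; case: (ltngtP l i) => [lt_li|/G0->|/val_inj eq_li].
  - by rewrite (IHe l (leq_trans lt_li le_ie) (ltn_trans lt_li lt_ik)) mulr0.
  - by rewrite mul0r.
  - by rewrite eq_li eqxx in ne_li.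
have W_k l : l != k -> W l k = 0.
  move=> ne_lk; case: (ltngtP l k) => [/Wlt|/W0|/val_inj eq_lk] //.
  by rewrite eq_lk eqxx in ne_lk.
have G'k x : G' x k = G x k * W k k.
  by rewrite defG' mxE (bigD1 k) //= big1 ?addr0 // => l /W_k->; rewrite mulr0.
(* Column [k] of [G'] is now [W k k] times that of [G]; once the two are known to lead in the same
   row, both leading ones force the factor to be 1. *)
suff eqck : c k = c' k.
  move=> l; case: eqVneq => [->|/W_k //].
  by have := G'1 k; rewrite G'k -eqck G1 mul1r.
have nzW : W k k != 0.
  apply: contraTneq (oner_neq0 K) => Wk0.
  by rewrite -(G'1 k) G'k Wk0 mulr0 eqxx.
apply: leading_inj (cP k) _; have [nz z] := c'P k; split=> [|x /z].
  by apply: contraNneq nz; rewrite !mxE G'k => ->; rewrite mul0r.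
by rewrite !mxE G'k => /eqP; rewrite mulf_eq0 (negPf nzW) orbF => /eqP.
Qed.

Lemma mulmx_perm (R : pzSemiRingType) m n (M : 'M[R]_(m, n)) (a : 'S_n) :
  M *m perm_mx a = col_perm a^-1 M.
Proof. by rewrite col_permE invgK. Qed.

(** Multiplying by [F^T] on the left lists the rank profile rows of [X F] in the order of the
    columns of [X F] that they lead; uniqueness uses triangularity in this form. *)
Lemma bruhat_data (K : fieldType) (m n r : nat) (A : 'M[K]_(m, n)) X F Y :
    \rank A = r -> @generalized_bruhat K m n r A X F Y ->
  exists a : 'S_r, exists c : 'I_r -> 'I_m, exists d : 'I_r -> 'I_n,
  [/\ [/\ A = X *m F *m Y, F = perm_mx a, row_full (X *m F) & row_free Y],
      [/\ {homo c : i j / (i < j)%N}, forall j, leading X^T j (c j)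
        & forall j, X (c j) j = 1],
      {homo d : i j / (i < j)%N} /\ (forall i, leading Y i (d i))
    & is_trig_mx (rowsub (fun i => c (a^-1%g i)) (X *m F))].
Proof.
move=> rA [defA echX X1 echY /is_perm_mxP[a defF] [rX trX]].
have Yfree : row_free Y by rewrite -row_leq_rank -{1}rA defA mxrankM_maxr.
have Gfull : row_full (X *m F) by rewrite -col_leq_rank -{1}rA defA mxrankM_maxl.
have [c c_incr cP] := row_echelonP echX (row_free_tr rX).
have [d d_incr dP] := row_echelonP echY Yfree.
exists a, c, d; split=> //; first by split=> // j; apply: X1.
congr is_trig_mx: trX; rewrite defF tr_perm_mx -row_permE !mulmx_perm.
apply/matrixP=> i j; rewrite !mxE castmxE mxE (RowRP_col_echelon rX c_incr cP).
by rewrite cast_ord_id.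
Qed.

Lemma bruhat_uniq (K : fieldType) (m n r : nat) (A : 'M[K]_(m, n)) X F Y X' F' Y' :
    \rank A = r -> @generalized_bruhat K m n r A X F Y ->
    @generalized_bruhat K m n r A X' F' Y' -> [/\ X' = X, F' = F & Y' = Y].
Proof.
move=> rA bruhat bruhat'.
have [a [c [d [[defA defF Gfull Yfree] [c_incr cP c1] [d_incr dP] trG]]]] :=
  bruhat_data rA bruhat.
have [a' [c' [d' [[defA' defF' _ Yfree'] [c'_incr c'P c'1] [d'_incr d'P] trG']]]] :=
  bruhat_data rA bruhat'.
have GE x k : (X *m F) x k = X x (a^-1%g k) by rewrite defF mulmx_perm mxE.
have GE' x k : (X' *m F') x k = X' x (a'^-1%g k) by rewrite defF' mulmx_perm mxE.
have GP k : leading (X *m F)^T k (c (a^-1%g k)).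
  have [nz z] := cP (a^-1%g k).
  by split=> [|x /z z0]; rewrite mxE GE; [move: nz | move: z0]; rewrite mxE.
have GP' k : leading (X' *m F')^T k (c' (a'^-1%g k)).
  have [nz z] := c'P (a'^-1%g k).
  by split=> [|x /z z0]; rewrite mxE GE'; [move: nz | move: z0]; rewrite mxE.
(* [X F] has full column rank, so its pseudo-inverse is a left inverse. *)
pose W := pinvmx (X *m F) *m (X' *m F').
have defY : Y = W *m Y'.
  by rewrite -mulmxA -defA' defA mulmxA mulVpmx // mul1mx.
have defG' : X' *m F' = X *m F *m W.
  by apply: (row_free_inj Yfree'); rewrite /= -defA' -mulmxA -defY.
have trW := echelon_transition d_incr dP d'_incr d'P defY.
have W1 : W = 1%:M.
  apply: (normal_cols_transition GP _ trG GP' _ trG' defG' trW) => k.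
    by rewrite GE c1.
  by rewrite GE' c'1.
have eqY : Y' = Y by rewrite defY W1 mul1mx.
have eqG : X' *m F' = X *m F by rewrite defG' W1 mulmx1.
have eqc k : c' (a'^-1%g k) = c (a^-1%g k).
  by apply: leading_inj (GP' k) _; rewrite eqG.
(* By [eqc], [c] sends [a^-1 (a' i)] to [c' i]; as [c] and [c'] are increasing, so is this map. *)
have f_id : (fun i => a^-1%g (a' i)) =1 id.
  apply: increasing_ord_id => i j lt_ij; rewrite -(increasing_mono c_incr).
  by rewrite -!eqc !permK c'_incr.
have eqF : F' = F.
  rewrite defF' defF; suff -> : a' = a by []; apply/permP=> i.
  by rewrite -[in RHS](f_id i) permKV.
split=> //; move: eqG; rewrite eqF => /(congr1 (mulmx^~ (invmx F))).
by rewrite !mulmxK // defF unitmx_perm.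
Qed.

(** * How elimination steps act on the original row and column order *)

Lemma rotationP p (k i : 'I_p) (s : 'S_p) : (k <= i)%N -> is_rotation k i s ->
  [/\ s k = i,
      forall x : 'I_p, (x < k)%N || (i < x)%N -> s x = x,
      forall x : 'I_p, (k <= x)%N -> (k <= s x)%N
    & forall x y : 'I_p, (k < x < y)%N -> (s x < s y)%N].
Proof.
move=> le_ki rot; split=> [|x x_out|x le_kx|x y /andP[lt_kx lt_xy]].
- by apply: val_inj; rewrite /= rot eqxx.
- apply: val_inj; rewrite /= rot -val_eqE /=.
  by case: eqVneq => [eq_xk|_]; [lia | case: ifP => //; lia].
- by rewrite rot -val_eqE /=; case: eqVneq => // ne_xk; case: ifP; lia.
rewrite !rot -!val_eqE /=; do 2!(case: eqVneq => [|_]; first by lia).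
by do 2!case: ifP; lia.
Qed.

(** The common ground of both column moves: a transposition may disorder the positions between [k]
    and [j], so no monotonicity is claimed there. *)
Lemma column_moveP n (k j : 'I_n) (t : 'S_n) : (k <= j)%N ->
    t = tperm k j \/ is_rotation k j t ->
  [/\ t k = j,
      forall y : 'I_n, (y < k)%N || (j < y)%N -> t y = y
    & forall y : 'I_n, (k <= y)%N -> (k <= t y)%N].
Proof.
move=> le_kj [-> | /(rotationP le_kj)[? ? ? _]]; last by [].
split=> [|y y_out|y le_ky]; first by rewrite tpermL.
  by rewrite tpermD // -val_eqE /=; lia.
by case: tpermP.
Qed.

Section GaussInvariant.
Variables (K : fieldType) (m n : nat).

(* After [k] steps, [p x] and [q y] are the original positions of row [x] and
   column [y]. A column transposition may disorder the columns that vanish in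
   the remaining matrix; the columns in [inv_cols] are nonzero there. In
   [inv_upper], row [x] may also lie below row [l]: a remaining column that is
   still nonzero comes after all processed pivots. *)
Record gauss_inv (k : nat) (p : 'S_m) (q : 'S_n) (B : 'M[K]_(m, n)) : Prop := {
  inv_rows : forall x y : 'I_m, (k <= x < y)%N -> (p x < p y)%N;
  inv_cols : forall (x x' : 'I_m) (y y' : 'I_n),
    (k <= x)%N -> (k <= x')%N -> (k <= y < y')%N ->
    B x y != 0 -> B x' y' != 0 -> (q y < q y')%N;
  inv_lower : forall (l x : 'I_m) (y : 'I_n),
    l = y :> nat -> (l < k)%N -> (l < x)%N -> B x y != 0 -> (p l < p x)%N;
  inv_upper : forall (x : 'I_m) (l y : 'I_n),
    (l < k)%N -> (l <= x)%N -> (l < y)%N -> B x y != 0 -> (q l < q y)%N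
}.

Lemma gauss_inv_step (k : 'I_m) (k' : 'I_n) p q B i j s t :
    gauss_inv k p q B -> k = k' :> nat -> is_pivot k B i j ->
    is_rotation k i s -> t = tperm k' j \/ is_rotation k' j t ->
  gauss_inv k.+1 (s * p) (t * q)
    (schur_update k k' (row_perm s (col_perm t B))).
Proof.
move=> [rowsP colsP lowP upP] eqk [le_ki le_kj nz_ij first_j top_i] rot_s move_t.
have [sk s_fix s_ge s_incr] := rotationP le_ki rot_s.
have le_k'j : (k' <= j)%N by rewrite -eqk.
have [tk t_fix t_ge] := column_moveP le_k'j move_t.
set B' := schur_update _ _ _.
have B'old (x : 'I_m) (y : 'I_n) :
    ~~ ((k < x)%N && (k' < y)%N) -> B' x y = B (s x) (t y).
  by move=> /negPf nlt; rewrite !mxE nlt.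
(* A nonzero updated entry needs a nonzero entry of [B] in the same column, either in its own row or
   in the pivot row [s k]. *)
have B'nz (l : nat) (x : 'I_m) (y : 'I_n) :
    (l <= k)%N -> (l <= x)%N -> B' x y != 0 ->
  exists2 x' : 'I_m, (l <= x')%N & B x' (t y) != 0.
  move=> le_lk le_lx; rewrite !mxE; case: ifP => [_ nz|_ nz]; last first.
    exists (s x) => //; case: (ltnP x k) => [lt_xk|/s_ge]; last exact: leq_trans.
    by rewrite s_fix ?lt_xk.
  have [z_x|nz_x] := eqVneq (B (s x) (t y)) 0; last first.
    exists (s x) => //; case: (ltnP x k) => [lt_xk|/s_ge]; last exact: leq_trans.
    by rewrite s_fix ?lt_xk.
  exists (s k); first by rewrite sk (leq_trans le_lk).
  by apply: contraNneq nz => ->; rewrite z_x mulr0 subr0.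
(* Columns before [j] vanish in the remaining block and [j] itself goes to position [k], so a
   nonzero column left over comes from beyond [j], where neither move acts. *)
have t_gt (x : 'I_m) (y : 'I_n) :
    (k <= x)%N -> (k < y)%N -> B x (t y) != 0 -> (j < t y)%N /\ t y = y.
  move=> le_kx lt_ky nz.
  have lt_j : (j < t y)%N.
    rewrite ltnNge leq_eqVlt; apply/negP=> /orP[/eqP/val_inj|lt_tj].
      by rewrite -tk => /perm_inj eq_yk; rewrite eq_yk -eqk ltnn in lt_ky.
    by rewrite first_j ?eqxx ?lt_tj ?andbT // eqk t_ge // -eqk ltnW in nz.
  by split=> //; apply: (@perm_inj _ t); rewrite t_fix ?lt_j ?orbT.
split=> [x y /andP[lt_kx lt_xy] | x x' y y' | l x y | x l y].
- rewrite !permM; have [lt_s|] := ltnP (s x) (s y); last first.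
    by rewrite leqNgt s_incr ?lt_kx.
  by rewrite rowsP // s_ge // ltnW.
- move=> lt_kx lt_kx' /andP[lt_ky lt_yy'].
  move=> /B'nz-/(_ k (leqnn k) (ltnW lt_kx))[x0 le_x0 nz0].
  move=> /B'nz-/(_ k (leqnn k) (ltnW lt_kx'))[x1 le_x1 nz1].
  have [_ ty] := t_gt _ _ le_x0 lt_ky nz0.
  have [_ ty'] := t_gt _ _ le_x1 (ltn_trans lt_ky lt_yy') nz1.
  rewrite !permM; apply: colsP le_x0 le_x1 _ nz0 nz1.
  by rewrite ty ty' (ltnW lt_ky).
- move=> eq_ly; rewrite ltnS leq_eqVlt => le_lk lt_lx.
  rewrite B'old; last by rewrite -eqk -eq_ly (ltnNge k l) (leq_eqVlt l k) le_lk andbF.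
  case/predU1P: le_lk => [/val_inj eq_lk|lt_lk] nz; rewrite !permM.
    (* New pivot: it is topmost in its column, so any other nonzero remaining entry there comes from
       below row [i], and [inv_rows] applies. *)
    have eq_yk : y = k' by apply: val_inj; rewrite /= -eq_ly eq_lk.
    rewrite eq_yk tk in nz; rewrite eq_lk in lt_lx *; rewrite sk.
    have le_ksx := s_ge _ (ltnW lt_lx).
    apply: rowsP; rewrite le_ki; case: (ltngtP i (s x)) => // [lt_sx|/val_inj].
      by rewrite top_i ?eqxx ?le_ksx in nz.
    by rewrite -sk => /perm_inj eq_kx; rewrite eq_kx ltnn in lt_lx.
  have ty : t y = y by rewrite t_fix // -eq_ly -eqk lt_lk.
  rewrite ty in nz; rewrite (s_fix l) ?lt_lk //; apply: (lowP _ _ _ eq_ly lt_lk _ nz).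
  case: (ltnP x k) => [lt_xk|/s_ge]; first by rewrite s_fix ?lt_xk.
  exact: leq_trans.
- rewrite ltnS leq_eqVlt => /predU1P[eq_lk|lt_lk] le_lx lt_ly.
    have -> : l = k' by apply: val_inj; rewrite /= eq_lk.
    rewrite eq_lk in le_lx lt_ly.
    move=> /B'nz-/(_ k (leqnn k) le_lx)[x0 le_x0 nz0].
    have [lt_j _] := t_gt _ _ le_x0 lt_ly nz0.
    rewrite !permM tk; apply: colsP le_ki le_x0 _ nz_ij nz0.
    by rewrite le_kj.
  move=> /B'nz-/(_ l (ltnW lt_lk) le_lx)[x0 le_x0 nz0].
  rewrite !permM (t_fix l) -?eqk ?lt_lk //; apply: (upP _ _ _ lt_lk le_x0 _ nz0).
  case: (ltnP y k') => [lt_yk|/t_ge]; first by rewrite t_fix ?lt_yk.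
  by apply: leq_trans; rewrite -eqk.
Qed.

Lemma gauss_steps_inv (A : 'M[K]_(m, n)) k P Q B : gauss_steps A k P Q B ->
  exists p : 'S_m, exists q : 'S_n,
    [/\ P = (perm_mx p)^T, Q = perm_mx q & gauss_inv k p q B].
Proof.
elim=> [|{}k k' {}P {}Q {}B i j s t _ [p [q [-> -> inv]]] eqk pivot rot_s move_t].
  exists 1%g, 1%g; split; rewrite ?perm_mx1 ?trmx1 //.
  by split=> //; [move=> x y /andP[] | move=> x x' y y' _ _ /andP[]]; rewrite !perm1.
exists (s * p)%g, (t * q)%g; rewrite !perm_mxM -trmx_mul; split=> //.
exact: gauss_inv_step inv eqk pivot rot_s move_t.
Qed.

End GaussInvariant.

(** * The decomposition read off from the elimination *)

Theorem corollary31 (K : fieldType) (m n r : nat) (A : 'M[K]_(m, n))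
    (rA : \rank A = r)
    (P : 'M[K]_m) (L : 'M[K]_(m, r)) (U : 'M[K]_(r, n)) (Q : 'M[K]_n)
    (A_PLUQ : is_PLUQ (rank_le_rows rA) (rank_le_cols rA) A P L U Q)
    (A_gauss : gauss_computes (rank_le_rows rA) (rank_le_cols rA) A P L U Q)
    (Stau Schi : 'M[K]_r)
    (Stau_perm : is_perm_mx Stau)
    (Stau_echelon :
       col_echelon (colsub (widen_ord (rank_le_rows rA)) P *m Stau))
    (Schi_perm : is_perm_mx Schi)
    (Schi_echelon :
       row_echelon (Schi *m rowsub (widen_ord (rank_le_cols rA)) Q)) :
  let X := P *m L *m Stau in
  let F := Stau^T *m Schi^T in
  let Y := Schi *m U *m Q in
  generalized_bruhat A X F Y /\
  forall (X' : 'M[K]_(m, r)) (F' : 'M[K]_r) (Y' : 'M[K]_(r, n)),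
    generalized_bruhat A X' F' Y' -> [/\ X' = X, F' = F & Y' = Y].
Proof.
move=> X F Y; suff bruhat : generalized_bruhat A X F Y.
  by split=> // X' F' Y'; apply: bruhat_uniq.
have [defA [_ _ [/is_trig_mxP Ltrig L1] [/is_trig_mxP Utrig U1]]] := A_PLUQ.
have [B [/gauss_steps_inv[p [q [defP defQ [_ _ lowP upP]]]] _ defL defU]] := A_gauss.
set wr := widen_ord (rank_le_rows rA) in Stau_echelon L1 defL defU.
set wc := widen_ord (rank_le_cols rA) in Schi_echelon U1 defL.
have nzB (k : 'I_r) : B (wr k) (wc k) != 0.
  by have := U1 k; rewrite defU mxE /= leqnn.
have L0 (i : 'I_m) (k : 'I_r) : (p i < p (wr k))%N -> L i k = 0.
  move=> lt_p; rewrite defL mxE; case: (ltngtP i k) => // [lt_ki|eq_ik].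
    have [->|/(lowP (wr k) i (wc k) erefl (ltn_ord k) lt_ki)] := eqVneq (B i (wc k)) 0.
      by rewrite mul0r.
    by rewrite ltnNge ltnW.
  have eq_i : i = wr k by apply: val_inj.
  by rewrite eq_i ltnn in lt_p.
have U0 (k : 'I_r) (j : 'I_n) : (q j < q (wc k))%N -> U k j = 0.
  move=> lt_q; rewrite defU mxE; case: (ltngtP k j) => // [lt_kj|eq_kj].
    have [//|/(upP (wr k) (wc k) j (ltn_ord k) (leqnn k) lt_kj)] := eqVneq (B (wr k) j) 0.
    by rewrite ltnNge ltnW.
  have eq_j : j = wc k by apply: val_inj.
  by rewrite eq_j ltnn in lt_q.
(* [inv_upper] is used in row [wr j], below pivot row [wr i]: its nonzero entry is the pivot of
   index [j]. *)
have q_incr : {homo (fun k => q (wc k)) : i j / (i < j)%N}.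
  move=> i j lt_ij; apply: (upP (wr j) (wc i) (wc j)) => //=; exact: ltnW.
have [/is_perm_mxP[a defStau] /is_perm_mxP[b defSchi]] := (Stau_perm, Schi_perm).
pose c k := p (wr (a^-1%g k)).
(* [c k] is the leading row of column [k] both in the permuted columns of [P] and in [X], so the
   echelon condition on the former carries over. *)
have c_incr : {homo c : i j / (i < j)%N}.
  have leadP k : leading (colsub wr P *m Stau)^T k (c k).
    split=> [|j lt_j]; rewrite defP defStau mulmx_perm !mxE.
      by rewrite eqxx oner_neq0.
    by case: eqP lt_j => // <-; rewrite /c ltnn.
  by have [_ incr] := Stau_echelon => i j lt_ij; apply: incr lt_ij _ _.
(* [Schi] makes [q (wc (b k))] increasing in [k]; since [q (wc k)] already is, [b] is increasing. *)
have b1 : b = 1%g.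
  have leadP k : leading (Schi *m rowsub wc Q) k (q (wc (b k))).
    split=> [|j lt_j]; rewrite defQ defSchi -row_permE !mxE.
      by rewrite eqxx oner_neq0.
    by case: eqP lt_j => // <-; rewrite ltnn.
  apply/permP=> i; rewrite perm1; move: i; apply: increasing_ord_id => i j lt_ij.
  rewrite -(increasing_mono q_incr).
  by have [_ incr] := Schi_echelon; apply: incr lt_ij _ _.
have Schi1 : Schi = 1%:M by rewrite defSchi b1 perm_mx1.
have XE x k : X (p x) k = L x (a^-1%g k).
  by rewrite /X defStau mulmx_perm mxE defP tr_perm_mx -row_permE mxE permK.
have YE k y : Y k (q y) = U k y.
  by rewrite /Y Schi1 mul1mx defQ mulmx_perm mxE permK.
have cP k : leading X^T k (c k).
  split=> [|x]; first by rewrite mxE XE L1 oner_neq0.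
  by rewrite mxE -(permKV p x) XE; apply: L0.
have dP k : leading Y k (q (wc k)).
  split=> [|y]; first by rewrite YE U1.
  by rewrite -(permKV q y) YE; apply: U0.
have defXFY : A = X *m F *m Y.
  rewrite defA /X /F /Y Schi1 trmx1 mulmx1 mul1mx defStau tr_perm_mx.
  by rewrite -(mulmxA _ (perm_mx a)) -perm_mxM mulgV perm_mx1 mulmx1 !mulmxA.
have rX : \rank X = r.
  apply/eqP; rewrite eqn_leq rank_leq_col -{1}rA defXFY -mulmxA.
  exact: mxrankM_maxl.
split=> //.
- exact: row_echelon_leading c_incr cP.
- by move=> i j /leading_inj-/(_ _ (cP j))->; rewrite XE L1.
- exact: row_echelon_leading q_incr dP.
- by rewrite /F Schi1 trmx1 mulmx1 is_perm_mx_tr.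
(* Row [c k] of [X] is row [a^-1 k] of [L] with permuted columns; conjugation by [F] undoes both
   permutations and leaves the leading block of [L]. *)
exists rX; apply/is_trig_mxP=> i j lt_ij.
rewrite /F Schi1 trmx1 mulmx1 trmxK defStau tr_perm_mx mulmx_perm invgK.
rewrite -row_permE !mxE castmxE mxE (RowRP_col_echelon rX c_incr cP) cast_ord_id.
by rewrite XE !permK Ltrig.
Qed.
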